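(* Consider the nonlinear system $x_{k+1}=f(x_k,u_k)$, $y_k=g(x_k,u_k)$ with a Koopman linear embedding $z_{k+1}=Az_k+Bu_k$, $y_k=Cz_k+Du_k$, $z_k=\Phi(x_k)\in\mathbb{R}^{n_z}$. Suppose that $l$ trajectories of length $L$ of the nonlinear system, $\mathrm{col}(u_d^i,y_d^i)\in\mathcal{B}_1|_L$, $i=1,\dots,l$, provide lifted excitation of order $L$. Then a length-$L$ sequence $\mathrm{col}(u,y)\in\mathbb{R}^{(m+p)L}$ is a valid trajectory of the Koopman linear embedding (i.e., $\mathrm{col}(u,y)\in\mathcal{B}_2|_L$) if and only if there exists $g\in\mathbb{R}^l$ such that $H_d\,g=\mathrm{col}(u,y)$, where $$H_d:=\begin{bmatrix}u_d^1&u_d^2&\cdots&u_d^l\\ y_d^1&y_d^2&\cdots&y_d^l\end{bmatrix}\in\mathbb{R}^{(m+p)L\times l}.$$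
   Context: Nonlinear system: $f:\mathbb{R}^n\times\mathbb{R}^m\to\mathbb{R}^n$, $g:\mathbb{R}^n\times\mathbb{R}^m\to\mathbb{R}^p$ are given; $x_k\in\mathbb{R}^n$, $u_k\in\mathbb{R}^m$, $y_k\in\mathbb{R}^p$ are state, input and output at time $k$. (The vector $g\in\mathbb{R}^l$ in the claim is unrelated to the output map $g$.) Koopman linear embedding: the nonlinear system admits a Koopman linear embedding if there exist linearly independent lifting functions $\phi_1,\dots,\phi_{n_z}:\mathbb{R}^n\to\mathbb{R}$ such that $\Phi(x):=\mathrm{col}(\phi_1(x),\dots,\phi_{n_z}(x))\in\mathbb{R}^{n_z}$ propagates linearly along all trajectories of the system and the output is a linear map of $\Phi(x_k)$ and $u_k$; that is, there are real matrices $A\in\mathbb{R}^{n_z\times n_z}$, $B\in\mathbb{R}^{n_z\times m}$, $C\in\mathbb{R}^{p\times n_z}$, $D\in\mathbb{R}^{p\times m}$ with $\Phi(f(x,u))=A\Phi(x)+Bu$ and $g(x,u)=C\Phi(x)+Du$ for all $x\in\mathbb{R}^n$, $u\in\mathbb{R}^m$. The associated linear system $z_{k+1}=Az_k+Bu_k$, $y_k=Cz_k+Du_k$ (with arbitrary $z_0\in\mathbb{R}^{n_z}$) is also called the Koopman linear embedding; it need not be controllable or observable. Notation: $\mathrm{col}$ denotes vertical stacking. $\mathcal{B}_1|_L$ is the set of $\mathrm{col}(u,y)\in\mathbb{R}^{(m+p)L}$, with $u=\mathrm{col}(u_0,\dots,u_{L-1})$, $y=\mathrm{col}(y_0,\dots,y_{L-1})$,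 for which there exists an initial state $x_0\in\mathbb{R}^n$ such that the nonlinear system equations hold along the sequence. $\mathcal{B}_2|_L$ is the set of $\mathrm{col}(u,y)\in\mathbb{R}^{(m+p)L}$ for which there exists an initial state $z_0\in\mathbb{R}^{n_z}$ such that the linear system equations hold along the sequence. Lifted excitation: $l\ge mL+n_z$ trajectories $\mathrm{col}(u_d^i,y_d^i)\in\mathcal{B}_1|_L$, $i=1,\dots,l$, with initial states $x_0^i\in\mathbb{R}^n$ (so that $\mathrm{col}(u_d^i,y_d^i)$ is generated by the nonlinear system from $x_0^i$), provide lifted excitation of order $L$ if the matrix $$H_K:=\begin{bmatrix}u_d^1&u_d^2&\cdots&u_d^l\\ \Phi(x_0^1)&\Phi(x_0^2)&\cdots&\Phi(x_0^l)\end{bmatrix}\in\mathbb{R}^{(mL+n_z)\times l}$$ has full row rank. *)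

(* Defs.v *)
From mathcomp Require Import all_boot all_order all_algebra.
From mathcomp Require Import classical_sets reals.

Set Implicit Arguments.
Unset Strict Implicit.
Unset Printing Implicit Defensive.

Import Order.TTheory GRing.Theory Num.Theory.
Local Open Scope ring_scope.
Local Open Scope classical_set_scope.

(* A signal col(v_0, ..., v_(L-1)) with v_k in R^d is a column vector of height
   \sum_(k < L) d, the height that \mxcol gives to a stack of L blocks; this is
   L * d, by a lemma and not by conversion. block v k is v_k. *)
Definition block (R : realType) (L d : nat)
    (v : 'cV[R]_(\sum_(k < L) d)) (k : 'I_L) : 'cV[R]_d :=
  @submxcol R L (fun=> d) 1 v k.

(* Only the values x 0, ..., x L of the state sequence are constrained. *)
Definition generated (R : realType) (n m p L : nat)
    (f : 'cV[R]_n -> 'cV[R]_m -> 'cV[R]_n)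
    (g : 'cV[R]_n -> 'cV[R]_m -> 'cV[R]_p)
    (x0 : 'cV[R]_n)
    (u : 'cV[R]_(\sum_(k < L) m)) (y : 'cV[R]_(\sum_(k < L) p)) : Prop :=
  exists x : nat -> 'cV[R]_n,
    x 0%N = x0 /\
    forall k : 'I_L,
      x k.+1 = f (x k) (block u k) /\ block y k = g (x k) (block u k).

Definition behavior (R : realType) (n m p L : nat)
    (f : 'cV[R]_n -> 'cV[R]_m -> 'cV[R]_n)
    (g : 'cV[R]_n -> 'cV[R]_m -> 'cV[R]_p) :
    set 'cV[R]_(\sum_(k < L) m + \sum_(k < L) p) :=
  [set w | exists x0 : 'cV[R]_n, generated f g x0 (usubmx w) (dsubmx w)].

Definition linear_map (R : realType) (a b c : nat)
    (M : 'M[R]_(c, a)) (N : 'M[R]_(c, b)) (z : 'cV[R]_a) (u : 'cV[R]_b) :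
    'cV[R]_c :=
  M *m z + N *m u.

Definition linear_behavior (R : realType) (nz m p L : nat)
    (A : 'M[R]_nz) (B : 'M[R]_(nz, m)) (C : 'M[R]_(p, nz)) (D : 'M[R]_(p, m)) :
    set 'cV[R]_(\sum_(k < L) m + \sum_(k < L) p) :=
  behavior (linear_map A B) (linear_map C D).

Definition linearly_independent (R : realType) (n nz : nat)
    (phi : 'I_nz -> 'cV[R]_n -> R) : Prop :=
  forall c : 'I_nz -> R,
    (forall x : 'cV[R]_n, \sum_(i < nz) c i * phi i x = 0) ->
    forall i : 'I_nz, c i = 0.

Definition lift_map (R : realType) (n nz : nat)
    (phi : 'I_nz -> 'cV[R]_n -> R) (x : 'cV[R]_n) : 'cV[R]_nz :=
  \col_(i < nz) phi i x.

Definition koopman_embedding (R : realType) (n m p nz : nat)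
    (f : 'cV[R]_n -> 'cV[R]_m -> 'cV[R]_n)
    (g : 'cV[R]_n -> 'cV[R]_m -> 'cV[R]_p)
    (phi : 'I_nz -> 'cV[R]_n -> R)
    (A : 'M[R]_nz) (B : 'M[R]_(nz, m))
    (C : 'M[R]_(p, nz)) (D : 'M[R]_(p, m)) : Prop :=
  [/\ linearly_independent phi,
      forall (x : 'cV[R]_n) (u : 'cV[R]_m),
        lift_map phi (f x u) = A *m lift_map phi x + B *m u
    & forall (x : 'cV[R]_n) (u : 'cV[R]_m),
        g x u = C *m lift_map phi x + D *m u].

Definition cols (R : realType) (d l : nat) (v : 'I_l -> 'cV[R]_d) :
    'M[R]_(d, l) :=
  \matrix_(r < d, i < l) v i r 0.

Definition data_matrix (R : realType) (m p L l : nat)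
    (ud : 'I_l -> 'cV[R]_(\sum_(k < L) m))
    (yd : 'I_l -> 'cV[R]_(\sum_(k < L) p)) :
    'M[R]_(\sum_(k < L) m + \sum_(k < L) p, l) :=
  col_mx (cols ud) (cols yd).

Definition lifted_data_matrix (R : realType) (n m nz L l : nat)
    (phi : 'I_nz -> 'cV[R]_n -> R)
    (ud : 'I_l -> 'cV[R]_(\sum_(k < L) m)) (x0 : 'I_l -> 'cV[R]_n) :
    'M[R]_(\sum_(k < L) m + nz, l) :=
  col_mx (cols ud) (cols (fun i => lift_map phi (x0 i))).

Definition lifted_excitation (R : realType) (n m p nz L l : nat)
    (f : 'cV[R]_n -> 'cV[R]_m -> 'cV[R]_n)
    (g : 'cV[R]_n -> 'cV[R]_m -> 'cV[R]_p)
    (phi : 'I_nz -> 'cV[R]_n -> R)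
    (ud : 'I_l -> 'cV[R]_(\sum_(k < L) m))
    (yd : 'I_l -> 'cV[R]_(\sum_(k < L) p))
    (x0 : 'I_l -> 'cV[R]_n) : Prop :=
  [/\ (m * L + nz <= l)%N,
      forall i : 'I_l, generated f g (x0 i) (ud i) (yd i)
    & row_free (lifted_data_matrix phi ud x0)].

(* Main.v *)
Require Import Defs.
From mathcomp Require Import all_boot all_order all_algebra.
From mathcomp Require Import classical_sets reals.

Local Open Scope ring_scope.

(** Lifting by [Phi] turns every trajectory of the nonlinear system into one of
    the linear system ([generated_lift]), and the trajectories of the linear
    system, tagged by their initial states, form a vector space
    ([generated_comb]).  Hence every combination of the columns of the data
    matrix is a linear trajectory.

    Conversely, a trajectory is determined by its input and its initial state
    ([generated_output_inj]).  Lifted excitation says that the pairs (input,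
    lifted initial state) of the data span the space of all pairs [(u, z0)], so
    a suitable combination of the data shares its input and its initial state
    with the given linear trajectory; the two outputs then coincide. *)

Section Columns.
Context {R : realType}.

Lemma colsD {d l : nat} (v w : 'I_l -> 'cV[R]_d) :
  cols (fun i => v i + w i) = cols v + cols w.
Proof. by apply/matrixP => r i; rewrite !mxE. Qed.

Lemma mul_cols {c d l : nat} (M : 'M[R]_(c, d)) (v : 'I_l -> 'cV[R]_d) :
  M *m cols v = cols (fun i => M *m v i).
Proof.
by apply/matrixP => r i; rewrite !mxE; apply: eq_bigr => j _; rewrite mxE.
Qed.

Lemma eq_cols {d l : nat} (v w : 'I_l -> 'cV[R]_d) :
  v =1 w -> cols v = cols w.
Proof. by move=> vw; apply/matrixP => r i; rewrite !mxE vw. Qed.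

Lemma block_cols_mul {L d l : nat} (v : 'I_l -> 'cV[R]_(\sum_(k < L) d))
    (h : 'cV[R]_l) (k : 'I_L) :
  block (cols v *m h) k = cols (fun i => block (v i) k) *m h.
Proof.
by apply/matrixP => r j; rewrite !mxE; apply: eq_bigr => i _; rewrite !mxE.
Qed.

Lemma block_inj {L d : nat} (v w : 'cV[R]_(\sum_(k < L) d)) :
  block v =1 block w -> v = w.
Proof.
move=> vw; rewrite -(submxcolK v) -(submxcolK w).
by apply: eq_mxcol => k; apply: vw.
Qed.

End Columns.

Section Trajectories.
Context {R : realType} {m p L : nat}.
Implicit Types (u : 'cV[R]_(\sum_(k < L) m)) (y : 'cV[R]_(\sum_(k < L) p)).

(** The recursion fixes the states up to time [L], hence the outputs. *)
Lemma generated_output_inj {n : nat} (f : 'cV[R]_n -> 'cV[R]_m -> 'cV[R]_n)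
    (g : 'cV[R]_n -> 'cV[R]_m -> 'cV[R]_p) (x0 : 'cV[R]_n) u y y' :
  generated f g x0 u y -> generated f g x0 u y' -> y = y'.
Proof.
move=> [x [x_0 xE]] [x' [x'_0 x'E]].
have eq_x k : (k < L)%N -> x k = x' k.
  elim: k => [|k IHk] ltkL; first by rewrite x_0 x'_0.
  have ltkL' := ltnW ltkL.
  have [-> _] := xE (Ordinal ltkL'); have [-> _] := x'E (Ordinal ltkL').
  by rewrite /= IHk.
apply: block_inj => k; have [_ ->] := xE k; have [_ ->] := x'E k.
by rewrite eq_x.
Qed.

Section Linear.
Context {nz : nat} (A : 'M[R]_nz) (B : 'M[R]_(nz, m)).
Context (C : 'M[R]_(p, nz)) (D : 'M[R]_(p, m)).

Lemma generated_lift {n : nat} (f : 'cV[R]_n -> 'cV[R]_m -> 'cV[R]_n)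
    (g : 'cV[R]_n -> 'cV[R]_m -> 'cV[R]_p) (phi : 'I_nz -> 'cV[R]_n -> R)
    (x0 : 'cV[R]_n) u y :
  koopman_embedding f g phi A B C D -> generated f g x0 u y ->
  generated (linear_map A B) (linear_map C D) (lift_map phi x0) u y.
Proof.
move=> [_ phif gE] [x [x_0 xE]]; exists (fun k => lift_map phi (x k)).
split=> [|k]; first by rewrite x_0.
by have [-> ->] := xE k; rewrite phif gE.
Qed.

Lemma linear_map_comb {c l : nat} (M : 'M[R]_(c, nz)) (N : 'M[R]_(c, m))
    (z : 'I_l -> 'cV[R]_nz) (v : 'I_l -> 'cV[R]_m) (h : 'cV[R]_l) :
  linear_map M N (cols z *m h) (cols v *m h)
  = cols (fun i => linear_map M N (z i) (v i)) *m h.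
Proof. by rewrite /linear_map colsD -!mul_cols mulmxDl !mulmxA. Qed.

(** Superposition: the same coefficients combine initial states, inputs and
    outputs. *)
Lemma generated_comb {l : nat} (z0 : 'I_l -> 'cV[R]_nz)
    (u : 'I_l -> 'cV[R]_(\sum_(k < L) m))
    (y : 'I_l -> 'cV[R]_(\sum_(k < L) p)) (h : 'cV[R]_l) :
  (forall i, generated (linear_map A B) (linear_map C D) (z0 i) (u i) (y i)) ->
  generated (linear_map A B) (linear_map C D)
    (cols z0 *m h) (cols u *m h) (cols y *m h).
Proof.
(* The state sequences are chosen at once for all the trajectories. *)
move=> /boolp.choice[z zE]; exists (fun k => cols (fun i => z i k) *m h).
split=> [|k].
  by congr (_ *m h); apply: eq_cols => i; have [] := zE i.
rewrite !block_cols_mul !linear_map_comb.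
by split; congr (_ *m h); apply: eq_cols => i; have [_ /(_ k)[]] := zE i.
Qed.

End Linear.
End Trajectories.

Theorem theorem2 (R : realType) (n m p nz L l : nat)
    (f : 'cV[R]_n -> 'cV[R]_m -> 'cV[R]_n)
    (g : 'cV[R]_n -> 'cV[R]_m -> 'cV[R]_p)
    (phi : 'I_nz -> 'cV[R]_n -> R)
    (A : 'M[R]_nz) (B : 'M[R]_(nz, m))
    (C : 'M[R]_(p, nz)) (D : 'M[R]_(p, m))
    (hK : koopman_embedding f g phi A B C D)
    (ud : 'I_l -> 'cV[R]_(\sum_(k < L) m))
    (yd : 'I_l -> 'cV[R]_(\sum_(k < L) p))
    (x0 : 'I_l -> 'cV[R]_n)
    (hB1 : forall i : 'I_l, behavior f g (col_mx (ud i) (yd i)))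
    (hE : lifted_excitation f g phi ud yd x0)
    (u : 'cV[R]_(\sum_(k < L) m)) (y : 'cV[R]_(\sum_(k < L) p)) :
  linear_behavior A B C D (col_mx u y) <->
  exists h : 'cV[R]_l, data_matrix ud yd *m h = col_mx u y.
Proof.
have [_ gen_d freeH] := hE.
have gen_comb h : generated (linear_map A B) (linear_map C D)
    (cols (fun i => lift_map phi (x0 i)) *m h) (cols ud *m h) (cols yd *m h).
  by apply: generated_comb => i; apply: generated_lift hK (gen_d i).
rewrite /linear_behavior /behavior /data_matrix /= col_mxKu col_mxKd.
split=> [[z0 gen_uy] | [h]]; last first.
  rewrite mul_col_mx => /eq_col_mx[<- <-].
  by exists (cols (fun i => lift_map phi (x0 i)) *m h).
have [h] : exists h, lifted_data_matrix phi ud x0 *m h = col_mx u z0.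
  have [H' HH'] := row_freeP freeH; exists (H' *m col_mx u z0).
  by rewrite mulmxA HH' mul1mx.
rewrite mul_col_mx => /eq_col_mx[uE z0E]; exists h.
rewrite mul_col_mx uE; congr col_mx.
by apply: generated_output_inj gen_uy; rewrite -uE -z0E; apply: gen_comb.
Qed.
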